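(* Let $Y$ be a finitely ramified fractal which is topologically rigid and whose metric is undistorted, and let $X$ be a metric space which is homeomorphic to $Y$. Then $X$ is quasisymmetrically equivalent to $Y$ if and only if the metric on $X$ is undistorted with respect to the cell structure on $X$ induced by a homeomorphism $X\to Y$.
   Context: A finitely ramified cell structure on a compact, connected, metrizable space $X$ consists of a locally finite rooted tree of subsets of $X$, called cells, such that: (1) every cell is compact, connected, and has nonempty interior; (2) the root is the whole space $X$, and each cell is the union of its children; (3) the intersection of any two distinct cells at the same level is a finite set; (4) for every infinite descending path $X=E_0\supseteq E_1\supseteq\cdots$ in the tree, $\bigcap_n E_n$ is a single point. Cells at level $n$ are called $n$-cells (the root being at level $0$). The same subset may occur at several levels; formally a cell is a pair $(E,n)$. A finitely ramified fractal is a metrizable space with a finitely ramified cell structure. A finitely ramified fractal $Y$ is topologically rigid if every self-homeomorphism of $Y$ preserves the cell structure (maps $n$-cells to $n$-cells for every $n$). If $X$ is homeomorphic to $Y$, the cell structure on $X$ induced by a homeomorphism $X\to Y$ is the one whose cells are the preimages of the cells of $Y$; when $Y$ is topologically rigid it does not depend on the choice of homeomorphism. Metrics are understood to induce the topology. A metric $d$ on a finitely ramified fractal is undistorted if: (Exponential Decay) there are constants $0<r\le R<1$ and $C\ge1$ such that $\frac{r^{n-m}}{C}\le\frac{\operatorname{diam}(E')}{\operatorname{diam}(E)}\le CR^{n-m}$ for every $m$-cell $E$ and $n$-cell $E'$ with $n\ge m$ and $E\cap E'\neq\emptyset$; and (Cell Separation) there is $\delta>0$ such that $d(E_1,E_2)\ge\delta\operatorname{diam}(E_1)$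 for every pair $E_1,E_2$ of disjoint $n$-cells (same $n$), where $d(E_1,E_2)=\inf\{d(x,y):x\in E_1,y\in E_2\}$. A homeomorphism $h\colon (X,d_X)\to (Y,d_Y)$ between metric spaces is a quasisymmetry if there is a homeomorphism $\eta\colon[0,\infty)\to[0,\infty)$ with $\frac{d_Y(h(a),h(b))}{d_Y(h(a),h(c))}\le \eta\left(\frac{d_X(a,b)}{d_X(a,c)}\right)$ for every triple $a,b,c$ of distinct points of $X$. Metric spaces $X$ and $Y$ are quasisymmetrically equivalent if there exists a quasisymmetry $X\to Y$. *)

(* Defs.v *)
From HB Require Import structures.
From mathcomp Require Import all_boot all_order all_algebra.
From mathcomp Require Import all_classical all_reals all_analysis.

Set Implicit Arguments.
Unset Strict Implicit.
Unset Printing Implicit Defensive.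

Import Order.TTheory GRing.Theory Num.Theory.
Import numFieldTopology.Exports.

Local Open Scope classical_set_scope.
Local Open Scope ring_scope.

Definition homeomorphism (S T : topologicalType) (f : S -> T) : Prop :=
  exists g : T -> S,
    [/\ cancel f g, cancel g f, continuous f & continuous g].

Definition set_homeomorphism (S T : topologicalType) (A : set S) (B : set T)
    (f : S -> T) : Prop :=
  exists g : T -> S,
    [/\ set_fun A B f /\ set_fun B A g,
        {in A, cancel f g} /\ {in B, cancel g f},
        {within A, continuous f} & {within B, continuous g}].

(* A levelled family of subsets with the edges of a tree on it.  The vertices
   are the pairs (E, n) with [cell C n E], so that the same subset may occur at
   several levels; [child C n E F] says that (F, n.+1) is a child of (E, n). *)
Record cell_tree (T : Type) := CellTree {
  cell : nat -> set (set T);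
  child : nat -> set T -> set T -> Prop
}.

(* Edges join consecutive levels, there is a single vertex at level 0, and
   every other vertex has exactly one parent: this is a rooted tree in which
   the level is the distance to the root. *)
Definition locally_finite_rooted_tree (T : Type) (C : cell_tree T) : Prop :=
  [/\ cell C 0%N = [set [set: T]],
      forall n E F, child C n E F -> cell C n E /\ cell C n.+1 F,
      forall n F, cell C n.+1 F -> exists! E, child C n E F &
      forall n E, cell C n E -> finite_set [set F | child C n E F]].

(* Compactness and connectedness of the space itself are the case of the root
   cell [set: T]. *)
Definition finitely_ramified (T : topologicalType) (C : cell_tree T) : Prop :=
  locally_finite_rooted_tree C /\
  [/\ forall n E, cell C n E -> [/\ compact E, connected E & E° !=set0],
      forall n E, cell C n E -> E = \bigcup_(F in [set F | child C n E F]) F,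
      forall n E F, cell C n E -> cell C n F -> E <> F ->
        finite_set (E `&` F) &
      forall E : nat -> set T, E 0%N = [set: T] ->
        (forall n, child C n (E n) (E n.+1)) ->
        exists x, \bigcap_n E n = [set x]].

Definition topologically_rigid (T : topologicalType) (C : cell_tree T) : Prop :=
  forall h : T -> T, homeomorphism h ->
    forall n E, cell C n E -> cell C n (h @` E).

Definition induced_cells (S T : Type) (phi : S -> T) (C : cell_tree T) :
    cell_tree S :=
  CellTree
    (fun n => [set phi @^-1` E | E in cell C n])
    (fun n A B => exists E F,
       [/\ child C n E F, A = phi @^-1` E & B = phi @^-1` F]).

(* [sup] and [inf] are the real-valued ones; they have their usual meaning here
   because [diam] is applied to nonempty bounded sets (compact cells) and
   [set_dist] to nonempty ones. *)
Definition diam (R : realType) (T : metricType R) (E : set T) : R :=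
  sup [set mdist x y | x in E & y in E].

Definition set_dist (R : realType) (T : metricType R) (E F : set T) : R :=
  inf [set mdist x y | x in E & y in F].

(* The bounds on diam E' / diam E are multiplied by diam E, which is positive
   unless the space is a single point; in that case, where the quotient would be
   0 / 0, they hold. *)
Definition exponential_decay (R : realType) (T : metricType R)
    (C : cell_tree T) : Prop :=
  exists r s c : R,
    [/\ 0 < r, r <= s, s < 1, 1 <= c &
      forall (m n : nat) (E E' : set T), (m <= n)%N ->
        cell C m E -> cell C n E' -> E `&` E' !=set0 ->
        r ^+ (n - m) / c * diam E <= diam E' <= c * s ^+ (n - m) * diam E].

Definition cell_separation (R : realType) (T : metricType R)
    (C : cell_tree T) : Prop :=
  exists2 delta : R, 0 < delta &
    forall (n : nat) (E1 E2 : set T), cell C n E1 -> cell C n E2 ->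
      E1 `&` E2 = set0 -> delta * diam E1 <= set_dist E1 E2.

Definition undistorted (R : realType) (T : metricType R)
    (C : cell_tree T) : Prop :=
  exponential_decay C /\ cell_separation C.

Definition quasisymmetry (R : realType) (S T : metricType R) (h : S -> T) :
    Prop :=
  homeomorphism h /\
  exists2 eta : R -> R,
    set_homeomorphism [set t : R | 0 <= t] [set t : R | 0 <= t] eta &
    forall a b c : S, a <> b -> a <> c -> b <> c ->
      mdist (h a) (h b) / mdist (h a) (h c) <=
        eta (mdist a b / mdist a c).

Definition quasisymmetrically_equivalent (R : realType) (S T : metricType R) :
    Prop :=
  exists h : S -> T, quasisymmetry h.

(* Main.v *)
(* Let n(a,b) be the largest n such that a and b lie in intersecting n-cells.
   For an undistorted metric, d(a,b) is comparable to the diameter of any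
   n(a,b)-cell containing a: exponential decay bounds it above, cell separation
   at level n(a,b)+1 bounds it below.  Hence d(a,b)/d(a,c) is controlled from both
   sides by exponentials in n(a,b) - n(a,c), and for two undistorted metrics
   with the same cells each ratio is bounded by a power of the other.

   Conversely, a quasisymmetry bounds ratios of diameters of intersecting cells.
   Separation follows at once; for the decay, diameters at least halve every N
   levels and shrink by at most a fixed factor at each level.  Rigidity
   identifies the cells pulled back by the quasisymmetry with those pulled back
   by the given homeomorphism. *)

Require Import Defs.
From mathcomp Require Import all_boot all_order all_algebra.
From mathcomp Require Import all_classical all_reals all_analysis.
From mathcomp Require Import ring lra.

Set Implicit Arguments.
Unset Strict Implicit.
Unset Printing Implicit Defensive.

Import Order.TTheory GRing.Theory Num.Theory.
Import numFieldTopology.Exports numFieldNormedType.Exports.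

Local Open Scope classical_set_scope.
Local Open Scope ring_scope.

(** * Bounded metrics, diameters and coverings by cells *)

(** The real-valued [sup] in [diam] is meaningful only on bounded sets; one global bound serves all
    cells at once. *)
Definition bounded_metric (R : realType) (T : metricType R) : Prop :=
  exists M : R, forall x y : T, mdist x y <= M.

(** The set-theoretic facts about cells used in the metric estimates; they pass directly to induced
    cells. *)
Definition cell_covering (T : Type) (C : cell_tree T) : Prop :=
  (forall n x, exists2 E, cell C n E & E x) /\
  (forall n E, cell C n E -> E !=set0).

Lemma mdist_le_diam (R : realType) (T : metricType R) (E : set T) (x y : T) :
  bounded_metric T -> E x -> E y -> mdist x y <= diam E.
Proof.
move=> [M hM] Ex Ey; apply: ub_le_sup; last by exists x => //; exists y.
by exists M => _ [u _ [v _ <-]].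
Qed.

Lemma diam_le (R : realType) (T : metricType R) (E : set T) (M : R) :
  E !=set0 -> (forall x y, E x -> E y -> mdist x y <= M) -> diam E <= M.
Proof.
move=> [x Ex] hM; apply: ge_sup; first by exists (mdist x x), x => //; exists x.
by move=> _ [u Eu [v Ev <-]]; exact: hM.
Qed.

Lemma diam_ge0 (R : realType) (T : metricType R) (E : set T) :
  bounded_metric T -> E !=set0 -> 0 <= diam E.
Proof. by move=> bT [x Ex]; rewrite -(mdistxx x); exact: mdist_le_diam. Qed.

Lemma set_dist_le_mdist (R : realType) (T : metricType R) (E F : set T)
    (x y : T) : E x -> F y -> set_dist E F <= mdist x y.
Proof.
move=> Ex Fy; apply: ge_inf; last by exists x => //; exists y.
by exists 0 => _ [u _ [v _ <-]]; exact: mdist_ge0.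
Qed.

Lemma le_set_dist (R : realType) (T : metricType R) (E F : set T) (M : R) :
  E !=set0 -> F !=set0 -> (forall x y, E x -> F y -> M <= mdist x y) ->
  M <= set_dist E F.
Proof.
move=> [x Ex] [y Fy] hM; apply: lb_le_inf.
  by exists (mdist x y), x => //; exists y.
by move=> _ [u Eu [v Ev <-]]; exact: hM.
Qed.

(** The distance to a fixed point is continuous, hence bounded on a compact space; the triangle
    inequality does the rest. *)
Lemma compact_bounded_metric (R : realType) (T : metricType R) :
  compact [set: T] -> bounded_metric T.
Proof.
move=> cT.
have [[x0 _]|T0] := pselect ([set: T] !=set0); last first.
  by exists 0 => x; exfalso; apply: T0; exists x.
have cd : continuous (mdist x0 : T -> R).
  move=> x; apply/cvgrPdist_le => e e0.
  have := @nbhsx_ballx _ _ x e e0; apply: filterS => y; rewrite ballEmdist /=.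
  have := metric_triangle x0 x y; have := metric_triangle x0 y x.
  rewrite (metric_sym y x) ler_norml; lra.
have /compact_bounded[M [_ hM]] := continuous_compact (continuous_subspaceT cd) cT.
have h x : mdist x0 x <= M + 1.
  have /= := hM (M + 1) _ (mdist x0 x); rewrite ltrDl ltr01 => /(_ isT) h.
  by apply: le_trans (ler_norm _) (h _); exists x.
exists (M + 1 + (M + 1)) => x y.
rewrite (le_trans (metric_triangle x x0 y))// (metric_sym x x0).
by rewrite lerD.
Qed.

Lemma finitely_ramified_covering (T : topologicalType) (C : cell_tree T) :
  finitely_ramified C -> cell_covering C.
Proof.
move=> [[C0 Cch _ _] [Cc CU _ _]]; split; last first.
  by move=> n E /Cc[_ _ [x xE]]; exists x; exact: interior_subset xE.
elim=> [|n IH] x; first by exists [set: T] => //; rewrite C0.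
have [E CE Ex] := IH x.
move: Ex; rewrite (CU _ _ CE) => -[F /= EF Fx].
by exists F => //; have [] := Cch _ _ _ EF.
Qed.

Lemma finitely_ramified_bounded (R : realType) (T : metricType R)
    (C : cell_tree T) : finitely_ramified C -> bounded_metric T.
Proof.
move=> [[C0 _ _ _] [Cc _ _ _]]; apply: compact_bounded_metric.
by have [] := Cc 0%N [set: T]; rewrite ?C0.
Qed.

Lemma homeomorphism_bounded (R : realType) (S T : metricType R)
    (C : cell_tree T) (h : S -> T) :
  finitely_ramified C -> homeomorphism h -> bounded_metric S.
Proof.
move=> [[C0 _ _ _] [Cc _ _ _]] [g [hg gh ch cg]]; apply: compact_bounded_metric.
have [cT _ _] : [/\ compact [set: T], connected [set: T] & [set: T]° !=set0].
  by apply: (Cc 0%N); rewrite C0.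
have := continuous_compact (continuous_subspaceT cg) cT.
by congr compact; apply/seteqP; split => // x _; exists (h x).
Qed.

Lemma induced_covering (S T : Type) (C : cell_tree T) (h : S -> T)
    (g : T -> S) : cancel g h -> cell_covering C ->
  cell_covering (induced_cells h C).
Proof.
move=> gh [cov ne]; split=> [n x|n _ [E CE <-]].
  by have [E CE Ex] := cov n (h x); exists (h @^-1` E) => //; exists E.
by have [y Ey] := ne _ _ CE; exists (g y); rewrite /preimage/= gh.
Qed.

Lemma geometric_small (R : realType) (s e : R) :
  0 <= s -> s < 1 -> 0 < e -> exists N, s ^+ N <= e.
Proof.
move=> s0 s1 e0.
have /cvgrPdist_le/(_ e e0)[N _ /(_ N (leqnn N))] :
    geometric 1 s @ \oo --> (0 : R) by apply: cvg_geometric; rewrite ger0_norm.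
rewrite /= sub0r normrN mul1r ger0_norm ?exprn_ge0// => h.
by exists N.
Qed.

(** * Separation levels and distances in undistorted metrics *)

Definition linked (T : Type) (C : cell_tree T) (n : nat) (a b : T) : Prop :=
  exists E F, [/\ cell C n E, cell C n F, E a, F b & E `&` F !=set0].

(** Linkedness at [n] bounds the distance above, failure at [n.+1] bounds it below. *)
Definition sep_level (T : Type) (C : cell_tree T) (n : nat) (a b : T) : Prop :=
  linked C n a b /\ ~ linked C n.+1 a b.

Lemma linked_induced (S T : Type) (C : cell_tree T) (h : S -> T) (g : T -> S)
    n a b : cancel g h ->
  linked (induced_cells h C) n a b <-> linked C n (h a) (h b).
Proof.
move=> gh; split=> [[_ [_ [[E CE <-] [F CF <-] Ea Fb [z [Ez Fz]]]]]|].
  by exists E, F; split=> //; exists (h z).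
move=> [E [F [CE CF Ea Fb [z [Ez Fz]]]]].
exists (h @^-1` E), (h @^-1` F); split=> //; [by exists E|by exists F|].
by exists (g z); rewrite /preimage/=; split; rewrite /= gh.
Qed.

(** Go from [a] to [b] through a common point of the two linking cells. Decay over zero levels makes
    intersecting cells of one level comparable up to [c], which gives [c + c ^+ 2]. *)
Lemma mdist_linked_le (R : realType) (T : metricType R) (C : cell_tree T)
    (bT : bounded_metric T) (r s c : R) (c1 : 1 <= c)
    (dec : forall (m n : nat) (E E' : set T), (m <= n)%N ->
       cell C m E -> cell C n E' -> E `&` E' !=set0 ->
       r ^+ (n - m) / c * diam E <= diam E' <= c * s ^+ (n - m) * diam E)
    n E a b : cell C n E -> E a -> linked C n a b ->
  mdist a b <= 2 * c ^+ 2 * diam E.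
Proof.
move=> CE Ea [E1 [F1 [CE1 CF1 Ea1 Fb1 [z [Ez Fz]]]]].
have h1 : diam E1 <= c * diam E.
  have /andP[_] := dec n n E E1 (leqnn n) CE CE1 (ex_intro _ a (conj Ea Ea1)).
  by rewrite subnn expr0 mulr1.
have h2 : diam F1 <= c * diam E1.
  have /andP[_] := dec n n E1 F1 (leqnn n) CE1 CF1 (ex_intro _ z (conj Ez Fz)).
  by rewrite subnn expr0 mulr1.
have d0 : 0 <= diam E1 by apply: diam_ge0 => //; exists a.
have h3 : mdist a b <= diam E1 + diam F1.
  by rewrite (le_trans (metric_triangle a z b))// lerD// mdist_le_diam.
have h4 : c * diam E1 <= c * (c * diam E) by rewrite ler_wpM2l//; lra.
have h5 : diam E1 <= c * diam E1 by rewrite ler_peMl.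
rewrite expr2; lra.
Qed.

(** Cells of level [n.+1] around [a] and [b] are disjoint, so separation applies to them; the lower
    decay bound over one level returns to [E]. *)
Lemma diam_unlinked_le (R : realType) (T : metricType R) (C : cell_tree T)
    (cov : cell_covering C) (r s c delta : R)
    (r0 : 0 < r) (c1 : 1 <= c) (d0 : 0 < delta)
    (dec : forall (m n : nat) (E E' : set T), (m <= n)%N ->
       cell C m E -> cell C n E' -> E `&` E' !=set0 ->
       r ^+ (n - m) / c * diam E <= diam E' <= c * s ^+ (n - m) * diam E)
    (sep : forall (n : nat) (E1 E2 : set T), cell C n E1 -> cell C n E2 ->
       E1 `&` E2 = set0 -> delta * diam E1 <= set_dist E1 E2)
    n E a b : cell C n E -> E a -> ~ linked C n.+1 a b ->
  diam E <= c / (r * delta) * mdist a b.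
Proof.
move=> CE Ea nl.
have [F CF Fa] := cov.1 n.+1 a; have [G CG Gb] := cov.1 n.+1 b.
have FG : F `&` G = set0.
  apply: contrapT => /eqP/set0P FG; apply: nl; exists F, G; split => //.
have h1 : delta * diam F <= mdist a b.
  by rewrite (le_trans (sep _ _ _ CF CG FG))// set_dist_le_mdist.
have /andP[h2 _] := dec n n.+1 E F (leqnSn n) CE CF (ex_intro _ a (conj Ea Fa)).
rewrite subSnn expr1 in h2.
have c0 : 0 < c by lra.
have h3 : delta * (r / c * diam E) <= mdist a b.
  by rewrite (le_trans _ h1)// ler_pM2l.
have -> : diam E = c / (r * delta) * (delta * (r / c * diam E)).
  by field; rewrite !gt_eqF.
by rewrite ler_pM2l// divr_gt0// mulr_gt0.
Qed.

(* At its separation level a pair is as far apart as a cell is wide, so ratios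
   of distances are ratios of cell diameters. *)
Lemma undistorted_gauge (R : realType) (T : metricType R) (C : cell_tree T) :
  bounded_metric T -> cell_covering C -> undistorted C ->
  exists K r s : R, [/\ 1 <= K, 0 < r, r <= s, s < 1 &
    forall a b c n m, (m <= n)%N -> sep_level C n a b -> sep_level C m a c ->
      r ^+ (n - m) / K * mdist a c <= mdist a b <=
      K * s ^+ (n - m) * mdist a c].
Proof.
move=> bT cov [[r [s [c [r0 rs s1 c1 dec]]]] [delta d0 sep]].
have c0 : 0 < c by lra.
have A := mdist_linked_le bT c1 dec.
have B := diam_unlinked_le cov r0 c1 d0 dec sep.
(* The sum dominates the constants of both preceding estimates. *)
pose K0 := 2 * c ^+ 2 + c / (r * delta).
have c2 : 1 <= c ^+ 2 by rewrite exprn_ege1.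
have q0 : 0 < c / (r * delta) by rewrite divr_gt0// mulr_gt0.
have K01 : 1 <= K0 by rewrite /K0; lra.
have K00 : 0 < K0 by lra.
have K02 : 1 <= K0 ^+ 2 by rewrite exprn_ege1.
(* Replacing distance by diameter costs [K0] for each pair; decay between the two cells costs
   [c]. *)
exists (c * K0 ^+ 2), r, s; split => //.
  by rewrite mulr_ege1.
move=> a b x n m mn [Lab Nab] [Lax Nax].
have [E CE Ea] := cov.1 n a; have [F CF Fa] := cov.1 m a.
have dE0 : 0 <= diam E by apply: diam_ge0 => //; exists a.
have dF0 : 0 <= diam F by apply: diam_ge0 => //; exists a.
have up G y k : cell C k G -> G a -> linked C k a y -> mdist a y <= K0 * diam G.
  move=> CG Ga /(A _ _ _ _ CG Ga) h; apply: le_trans h _.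
  rewrite ler_wpM2r// ?diam_ge0 //; first by exists a.
  rewrite /K0; lra.
have dn G y k : cell C k G -> G a -> ~ linked C k.+1 a y ->
    diam G <= K0 * mdist a y.
  move=> CG Ga /(B _ _ _ _ CG Ga) h; apply: le_trans h _.
  rewrite ler_wpM2r ?mdist_ge0// /K0; lra.
have /andP[lo hi] := dec m n F E mn CF CE (ex_intro _ a (conj Fa Ea)).
have s0 : 0 < s by lra.
have cs0 : 0 < c * s ^+ (n - m) by rewrite mulr_gt0// exprn_gt0.
have rc0 : 0 < r ^+ (n - m) / c by rewrite divr_gt0// exprn_gt0.
apply/andP; split.
- have h1 : r ^+ (n - m) / c * mdist a x <= r ^+ (n - m) / c * (K0 * diam F).
    by rewrite ler_pM2l// (up _ _ _ CF Fa).
  have h2 : K0 * (r ^+ (n - m) / c * diam F) <= K0 * diam E by rewrite ler_pM2l.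
  have h3 : K0 * diam E <= K0 * (K0 * mdist a b).
    by rewrite ler_pM2l// (dn _ _ _ CE Ea).
  have -> : r ^+ (n - m) / (c * K0 ^+ 2) * mdist a x =
            (r ^+ (n - m) / c * mdist a x) / K0 ^+ 2.
    by field; rewrite !gt_eqF.
  rewrite ler_pdivrMr ?exprn_gt0// expr2; lra.
- have h1 : mdist a b <= K0 * diam E by exact: up Lab.
  have h2 : K0 * diam E <= K0 * (c * s ^+ (n - m) * diam F) by rewrite ler_pM2l.
  have h3 : K0 * (c * s ^+ (n - m) * diam F) <=
            K0 * (c * s ^+ (n - m) * (K0 * mdist a x)).
    by rewrite ler_pM2l// ler_pM2l// (dn _ _ _ CF Fa).
  rewrite expr2; lra.
Qed.

(** Points linked at level [n] are within a constant times [s ^+ n], so distinct points are linked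
    at boundedly many levels. The root links them at level 0; take the largest level. *)
Lemma sep_level_exists (R : realType) (T : metricType R) (C : cell_tree T) :
  finitely_ramified C -> exponential_decay C ->
  forall a b : T, a <> b -> exists n, sep_level C n a b.
Proof.
move=> fr [r [s [c [r0 rs s1 c1 dec]]]] a b ab.
have bT := finitely_ramified_bounded fr.
have cov := finitely_ramified_covering fr.
have C0 : cell C 0%N [set: T] by case: fr => -[-> _ _ _] _.
have d0 : 0 < mdist a b by rewrite mdist_gt0; apply/eqP.
have D0 : 0 <= diam [set: T] by apply: diam_ge0 => //; exists a.
have L0 : linked C 0 a b.
  by exists [set: T], [set: T]; split => //; exists a.
(* The [+ 1] makes [M] positive at once, and the 2 in the threshold below makes the contradiction
   strict. *)
pose M := 2 * c ^+ 2 * (c * (diam [set: T] + 1)).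
have M0 : 0 < M.
  by rewrite !mulr_gt0 ?exprn_gt0//; lra.
have s0 : 0 < s by lra.
have [|N sN] := @geometric_small _ s (mdist a b / (2 * M)) (ltW s0) s1.
  by rewrite divr_gt0// mulr_gt0.
have bd n : linked C n a b -> (n <= N)%N.
  move=> L; rewrite leqNgt; apply/negP => Nn.
  have [E CE Ea] := cov.1 n a.
  have h1 := mdist_linked_le bT c1 dec CE Ea L.
  have /andP[_ h2] := dec 0%N n setT E (leq0n n) C0 CE (ex_intro _ a (conj I Ea)).
  rewrite subn0 in h2.
  have h3 : s ^+ n <= s ^+ N by apply: ler_wiXn2l; rewrite ?(ltW s0) ?(ltW s1) ?(ltnW Nn).
  have sn0 : 0 < s ^+ n by rewrite exprn_gt0.
  have h4 : 2 * c ^+ 2 * diam E <= M * s ^+ n.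
    have h5 : c * s ^+ n * diam [set: T] <= c * s ^+ n * (diam [set: T] + 1).
      by rewrite ler_wpM2l ?mulr_ge0 //; lra.
    have h6 : 2 * c ^+ 2 * diam E <= 2 * c ^+ 2 * (c * s ^+ n * (diam [set: T] + 1)).
      by rewrite ler_wpM2l ?mulr_ge0 ?exprn_ge0//; lra.
    by rewrite /M; lra.
  have h7 : M * s ^+ n <= M * (mdist a b / (2 * M)).
    by rewrite ler_pM2l// (le_trans h3).
  have : M * (mdist a b / (2 * M)) = mdist a b / 2 by field; rewrite gt_eqF.
  lra.
have ex : exists n, `[< linked C n a b >] by exists 0%N; apply/asboolP.
have ub n : `[< linked C n a b >] -> (n <= N)%N by move/asboolP; exact: bd.
case: (ex_maxnP ex ub) => n /asboolP Ln mx; exists n; split => // Ln1.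
by have := mx n.+1; rewrite ltnn => /(_ (asboolT Ln1)).
Qed.

(** * Cell diameters under a quasisymmetry *)

(** Otherwise all of [F] lies within a quarter of its diameter from [p], so the diameter is at most
    half of itself, yet positive by the case [q = p]. With 4 in place of 2 the supremum need not be
    attained. *)
Lemma diam_half_le (R : realType) (T : metricType R) (F : set T) (p : T) :
  bounded_metric T -> F p -> exists2 q, F q & diam F <= 4 * mdist p q.
Proof.
move=> bT Fp; apply: contrapT => no.
have lt q : F q -> 4 * mdist p q < diam F.
  by move=> Fq; rewrite ltNge; apply/negP => h; apply: no; exists q.
have d0 := lt p Fp; rewrite mdistxx mulr0 in d0.
have : diam F <= diam F / 2.
  apply: diam_le; first by exists p.
  move=> x y Fx Fy.
  have := lt x Fx; have := lt y Fy; have := metric_triangle x p y.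
  rewrite (metric_sym x p); lra.
lra.
Qed.

(** Compare each point of [E] with a point [q] of [F] far from [p]: the distance ratio is at most
    [4 * t]. The factor 2 is the triangle inequality through [g p]. *)
Lemma qs_diam_le (R : realType) (X Y : metricType R) (h : X -> Y) (g : Y -> X)
    (gh : cancel g h) (theta : R -> R) (bX : bounded_metric X)
    (bY : bounded_metric Y)
    (theta0 : forall t, 0 <= t -> 0 <= theta t)
    (htheta : forall a b c t, 0 <= t ->
      mdist (h a) (h b) <= t * mdist (h a) (h c) ->
      mdist a b <= theta t * mdist a c)
    (E F : set Y) (p : Y) (t : R) : E p -> F p -> 0 <= t ->
  diam E <= t * diam F ->
  diam (h @^-1` E) <= 2 * theta (4 * t) * diam (h @^-1` F).
Proof.
move=> Ep Fp t0 EF.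
have [q Fq dq] := diam_half_le bY Fp.
have t40 : 0 <= 4 * t by lra.
have dX x : E (h x) -> mdist (g p) x <= theta (4 * t) * diam (h @^-1` F).
  move=> Ex; apply: (@le_trans _ _ (theta (4 * t) * mdist (g p) (g q))).
    apply: htheta => //; rewrite !gh.
    have h1 : mdist p (h x) <= diam E by exact: mdist_le_diam.
    have h2 : t * diam F <= t * (4 * mdist p q) by rewrite ler_wpM2l.
    lra.
  by rewrite ler_wpM2l ?theta0// mdist_le_diam// /preimage/= gh.
apply: diam_le; first by exists (g p); rewrite /preimage/= gh.
move=> x y Ex Ey; have := dX x Ex; have := dX y Ey.
have := metric_triangle x (g p) y; rewrite (metric_sym x (g p)); lra.
Qed.

Lemma bernoulli_le (R : realType) (x : R) n :
  0 <= x <= 1 -> 1 - n%:R * x <= (1 - x) ^+ n.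
Proof.
move=> /andP[x0 x1]; elim: n => [|n IH]; first by rewrite mul0r subr0 expr0.
rewrite exprS -natr1.
have h1 : (1 - x) * (1 - n%:R * x) <= (1 - x) * (1 - x) ^+ n.
  by rewrite ler_wpM2l//; lra.
have : 0 <= n%:R * (x * x) by rewrite !mulr_ge0.
lra.
Qed.

(** Turns halving every [N.+1] levels into a rate per level. Bernoulli's inequality with step
    [1 / (2 (N + 1))] replaces an exact root of 1/2. *)
Lemma root_half_exists (R : realType) N :
  exists2 s : R, 2^-1 <= s < 1 & forall k, (k <= N.+1)%N -> 2^-1 <= s ^+ k.
Proof.
pose x : R := (2 * N.+1%:R)^-1.
have N1 : 1 <= N.+1%:R :> R by rewrite ler1n.
have x0 : 0 < x by rewrite invr_gt0; lra.
have x1 : x <= 2^-1 by rewrite /x lef_pV2 ?posrE; lra.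
have Nx : N.+1%:R * x = 2^-1 by rewrite /x; field; rewrite !gt_eqF//; lra.
exists (1 - x); first by apply/andP; split; lra.
move=> k kN; apply: le_trans (bernoulli_le k _); last by apply/andP; split; lra.
have : k%:R * x <= N.+1%:R * x by rewrite ler_wpM2r ?ler_nat//; lra.
lra.
Qed.

(** * Undistortedness pulls back along a quasisymmetry *)

Section quasisymmetric_pullback.
Context (R : realType) (X Y : metricType R) (C : cell_tree Y).
Context (h : X -> Y) (g : Y -> X) (theta : R -> R).
Hypothesis gh : cancel g h.
Hypotheses (bX : bounded_metric X) (bY : bounded_metric Y).
Hypothesis cov : cell_covering C.
Hypothesis theta0 : forall t, 0 <= t -> 0 <= theta t.
Hypothesis theta_small : forall e, 0 < e -> exists2 t, 0 < t & theta t <= e.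
Hypothesis htheta : forall a b c t, 0 <= t ->
  mdist (h a) (h b) <= t * mdist (h a) (h c) ->
  mdist a b <= theta t * mdist a c.

Let pullback_diam_ge0 n E : cell C n E -> 0 <= diam (h @^-1` E).
Proof.
move=> CE; apply: diam_ge0 => //; have [y Ey] := cov.2 n E CE.
by exists (g y); rewrite /preimage/= gh.
Qed.

(** All comparisons run through cells containing one common point, which need not be nested; [L1]
    absorbs the change between cells of the same level. *)
Lemma pullback_exponential_decay :
  exponential_decay C -> exponential_decay (induced_cells h C).
Proof.
move=> [r [s [c [r0 rs s1 c1 dec]]]].
have c0 : 0 < c by lra.
have s0 : 0 < s by lra.
have dX := qs_diam_le gh bX bY theta0 htheta.
pose L0 := 2 * theta (4 * c).
have L00 : 0 <= L0 by rewrite /L0; have := theta0 (t := 4 * c); lra.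
pose L := 2 * theta (4 * (c / r)).
have cr0 : 0 < c / r by rewrite divr_gt0.
have L_ge0 : 0 <= L by rewrite /L; have := theta0 (t := 4 * (c / r)); lra.
(* With [theta t <= 1/4], the factor 2 of [qs_diam_le] leaves 1/2; its argument is [4 * (t / 4)], so
   [c * s ^+ N <= t / 4] is required. *)
have [t t0 tt] := theta_small (e := 4^-1) ltac:(lra).
have [|N0 sN0] := @geometric_small _ s (t / 4 / c) (ltW s0) s1.
  by rewrite !divr_gt0.
(* Positive, so that going back [N] levels decreases [k] in the strong induction for [upper]. *)
pose N := N0.+1.
have sN : c * s ^+ N <= t / 4.
  have : s ^+ N <= s ^+ N0.
    by apply: ler_wiXn2l; rewrite ?(ltW s0) ?(ltW s1) ?leqnSn.
  move=> sNN; have : c * s ^+ N <= c * (t / 4 / c).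
    by rewrite ler_pM2l// (le_trans sNN).
  by rewrite [c * (_ / c)]mulrC divfK // gt_eqF.
(* [+ 2] ensures [rho <= 1/2 <= s'] *)
pose rho := (L + 2)^-1.
have rho0 : 0 < rho by rewrite invr_gt0; lra.
have rho2 : rho <= 2^-1 by rewrite /rho lef_pV2 ?posrE; lra.
have [s' /andP[s'2 s'1] hs'] := root_half_exists R N0.
have s'0 : 0 < s' by lra.
pose L1 := 1 + L0.
have coarse m n E E' p : (m <= n)%N -> cell C m E -> cell C n E' -> E p ->
    E' p -> diam (h @^-1` E') <= L1 * diam (h @^-1` E).
  move=> mn CE CE' Ep E'p.
  have /andP[_ hi] := dec m n E E' mn CE CE' (ex_intro _ p (conj Ep E'p)).
  have h1 : c * s ^+ (n - m) * diam E <= c * diam E.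
    rewrite ler_wpM2r ?diam_ge0//; first by exists p.
    by rewrite ler_piMr ?(ltW c0)// exprn_ile1 ?(ltW s0) ?(ltW s1).
  have := dX E' E p c E'p Ep (ltW c0) (le_trans hi h1).
  by rewrite -/L0 /L1; have := pullback_diam_ge0 CE; lra.
have coarse_rev m E E' p : cell C m E -> cell C m E' -> E p ->
    E' p -> diam (h @^-1` E) <= L1 * diam (h @^-1` E').
  by move=> CE CE' Ep E'p; exact: coarse (leqnn m) CE' CE E'p Ep.
have halve m E E' p : cell C m E -> cell C (m + N) E' -> E p -> E' p ->
    diam (h @^-1` E') <= 2^-1 * diam (h @^-1` E).
  move=> CE CE' Ep E'p.
  have /andP[_ hi] :=
    dec m (m + N)%N E E' (leq_addr _ _) CE CE' (ex_intro _ p (conj Ep E'p)).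
  rewrite addKn in hi.
  have h1 : c * s ^+ N * diam E <= t / 4 * diam E.
    by rewrite ler_wpM2r ?diam_ge0//; exists p.
  have := dX E' E p (t / 4) E'p Ep ltac:(lra) (le_trans hi h1).
  have -> : 4 * (t / 4) = t by field.
  have : theta t * diam (h @^-1` E) <= 4^-1 * diam (h @^-1` E).
    by rewrite ler_wpM2r// (pullback_diam_ge0 CE).
  lra.
have step m E E' p : cell C m E -> cell C m.+1 E' -> E p -> E' p ->
    rho * diam (h @^-1` E) <= diam (h @^-1` E').
  move=> CE CE' Ep E'p.
  have /andP[lo _] :=
    dec m m.+1 E E' (leqnSn m) CE CE' (ex_intro _ p (conj Ep E'p)).
  rewrite subSnn expr1 in lo.
  have h1 : diam E <= c / r * diam E'.
    have -> : diam E = c / r * (r / c * diam E) by field; rewrite !gt_eqF.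
    by rewrite ler_pM2l.
  have := dX E E' p (c / r) Ep E'p (ltW cr0) h1; rewrite -/L => h2.
  have dE' := pullback_diam_ge0 CE'.
  have -> : rho * diam (h @^-1` E) = diam (h @^-1` E) / (L + 2) by rewrite mulrC.
  by rewrite ler_pdivrMr; lra.
have lower k m E E' p : cell C m E -> cell C (m + k) E' -> E p -> E' p ->
    rho ^+ k * diam (h @^-1` E) <= L1 * diam (h @^-1` E').
  elim: k E' => [|k IH] E' CE CE' Ep E'p.
    rewrite expr0 mul1r; rewrite addn0 in CE'.
    exact: coarse_rev CE CE' Ep E'p.
  rewrite addnS in CE'.
  have [G CG Gp] := cov.1 (m + k)%N p.
  have h1 := IH G CE CG Ep Gp.
  have h2 := step _ _ _ _ CG CE' Gp E'p.
  rewrite exprS -mulrA.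
  have h3 : rho * (rho ^+ k * diam (h @^-1` E)) <= rho * (L1 * diam (h @^-1` G)).
    by rewrite ler_pM2l.
  have h4 : L1 * (rho * diam (h @^-1` G)) <= L1 * diam (h @^-1` E').
    by rewrite ler_wpM2l// /L1; lra.
  lra.
(* For [k <= N] use [coarse], where the factor 2 compensates [s' ^+ k >= 1/2]; beyond that, go back
   [N] levels, halve, and use [1/2 <= s' ^+ N]. *)
have upper k m E E' p : cell C m E -> cell C (m + k) E' -> E p -> E' p ->
    diam (h @^-1` E') <= 2 * L1 * s' ^+ k * diam (h @^-1` E).
  elim/ltn_ind: k E' => k IH E' CE CE' Ep E'p.
  have dE := pullback_diam_ge0 CE.
  have [kN|Nk] := leqP k N.
    apply: le_trans (coarse _ _ _ _ _ (leq_addr _ _) CE CE' Ep E'p) _.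
    rewrite ler_wpM2r//.
    have := hs' k kN; have L10 : 0 <= 2 * L1 by rewrite /L1; lra.
    by move=> /(ler_wpM2l L10); lra.
  have [G CG Gp] := cov.1 (m + (k - N))%N p.
  have hk : (k - N < k)%N by rewrite ltn_subrL /= (leq_trans _ Nk).
  have h1 := IH _ hk G CE CG Ep Gp.
  have eN : (m + k = m + (k - N) + N)%N by rewrite -addnA subnK // ltnW.
  rewrite eN in CE'.
  have h2 := halve _ _ _ _ CG CE' Gp E'p.
  have dG := pullback_diam_ge0 CG.
  have h3 : 2^-1 * diam (h @^-1` G) <= s' ^+ N * diam (h @^-1` G).
    by rewrite ler_wpM2r// hs'.
  have h4 : s' ^+ N * diam (h @^-1` G) <=
      s' ^+ N * (2 * L1 * s' ^+ (k - N) * diam (h @^-1` E)).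
    by rewrite ler_pM2l// exprn_gt0.
  have -> : s' ^+ k = s' ^+ N * s' ^+ (k - N) by rewrite -exprD subnKC // ltnW.
  lra.
exists rho, s', (2 * L1); split => //; [lra|rewrite /L1; lra|].
move=> m n _ _ mn [E CE <-] [E' CE' <-] [x [Ex E'x]].
rewrite -(subnKC mn) in CE'.
have dE' := pullback_diam_ge0 CE'.
have lo := lower _ _ _ _ _ CE CE' Ex E'x.
have L10 : 0 < 2 * L1 by rewrite /L1; lra.
apply/andP; split; last exact: upper CE CE' Ex E'x.
rewrite mulrAC ler_pdivrMr//.
by apply: le_trans lo _; rewrite mulrC ler_wpM2l// /L1; lra.
Qed.

(** In [Y] the diameter of [F1] is at most [delta^-1] times the distance from [h x] to [h y], so
    [theta delta^-1] bounds how far [F1] extends from [x] after pullback. *)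
Lemma pullback_cell_separation :
  cell_separation C -> cell_separation (induced_cells h C).
Proof.
move=> [delta delta0 sep].
have ne F n : cell C n F -> h @^-1` F !=set0.
  by move=> /cov.2[y Fy]; exists (g y); rewrite /preimage/= gh.
have di0 : 0 <= delta^-1 by rewrite invr_ge0 ltW.
have th0 := theta0 di0.
(* The [+ 1] keeps the denominator positive even if [theta delta^-1] is 0. *)
exists (2 * (theta delta^-1 + 1))^-1; first by rewrite invr_gt0; lra.
move=> n _ _ [F1 CF1 <-] [F2 CF2 <-] F12.
have FF : F1 `&` F2 = set0.
  apply/seteqP; split=> // y [F1y F2y].
  have : (h @^-1` F1 `&` h @^-1` F2) (g y) by rewrite /preimage; split; rewrite /= gh.
  by rewrite F12.
apply: le_set_dist; [exact: ne CF1|exact: ne CF2|].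
move=> x y F1x F2y.
have dxy := mdist_ge0 x y.
have near_x z : F1 (h z) -> mdist x z <= theta delta^-1 * mdist x y.
  move=> F1z; apply: htheta => //; rewrite mulrC ler_pdivlMr// mulrC.
  apply: le_trans (@set_dist_le_mdist _ _ F1 F2 (h x) (h y) F1x F2y).
  apply: le_trans (sep _ _ _ CF1 CF2 FF).
  by rewrite ler_pM2l// mdist_le_diam.
rewrite mulrC ler_pdivrMr; last lra.
apply: diam_le; first exact: ne CF1.
move=> u v /near_x hu /near_x hv.
by have := metric_triangle u x v; rewrite (metric_sym u x); lra.
Qed.

Lemma pullback_undistorted : undistorted C -> undistorted (induced_cells h C).
Proof.
by move=> [? ?]; split;
  [exact: pullback_exponential_decay|exact: pullback_cell_separation].
Qed.

End quasisymmetric_pullback.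

(** * Control functions on the half-line *)

(** A continuous injection on an interval is strictly monotone. What is kept is a monotone bijection
    with its inverse, enough to invert the control. *)
Lemma nneg_homeomorphism_le (R : realType) (eta : R -> R) :
  set_homeomorphism [set t : R | 0 <= t] [set t : R | 0 <= t] eta ->
  exists g : R -> R,
    [/\ forall t, 0 <= t -> 0 <= eta t /\ 0 <= g t,
        forall t, 0 <= t -> g (eta t) = t /\ eta (g t) = t &
        forall x y, 0 <= x -> x <= y -> eta x <= eta y].
Proof.
move=> [g [[fe fg] [eK gK] ce _]]; exists g.
have pe t : 0 <= t -> 0 <= eta t by exact: fe.
have pg t : 0 <= t -> 0 <= g t by exact: fg.
have eK' t : 0 <= t -> g (eta t) = t by move=> t0; apply: eK; rewrite inE.
have gK' t : 0 <= t -> eta (g t) = t by move=> t0; apply: gK; rewrite inE.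
split=> [t t0|t t0|x y x0 xy]; [by split; auto|by split; auto|].
have ce' : {within [set` `[0, +oo[], continuous eta}.
  by rewrite set_itvE; exact: ce.
have inj : {in `[0, +oo[ &, injective eta}.
  move=> u v; rewrite !in_itv /= !andbT => u0 v0 uv.
  by rewrite -(eK' u)// uv eK'.
have [inc|dec] := itv_continuous_inj_mono ce' inj.
  have [->//|xy'] := eqVneq x y.
  apply/ltW/inc; rewrite ?in_itv /= ?andbT//; first exact: le_trans xy.
  by rewrite lt_neqAle xy' xy.
(* a decreasing [eta] would be bounded by [eta 0], hence not surjective *)
have e0 : 0 <= eta 0 by exact: pe.
have u0 : 0 <= eta 0 + 1 by lra.
have [g0|g0] := eqVneq (g (eta 0 + 1)) 0.
  by have := gK' _ u0; rewrite g0; lra.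
have : eta (g (eta 0 + 1)) < eta 0.
  apply: dec; rewrite ?in_itv /= ?andbT ?lexx//; first exact: pg.
  by rewrite lt_neqAle eq_sym g0 pg.
rewrite gK'//; lra.
Qed.

(* The control of the inverse quasisymmetry is [t |-> 1 / eta^-1 (1 / t)]; taking
   the maximum with [t] also covers triples whose points are not distinct. *)
Lemma quasisymmetry_inverse_control (R : realType) (X Y : metricType R)
    (h : X -> Y) : quasisymmetry h ->
  exists theta : R -> R,
    [/\ forall t, 0 <= t -> 0 <= theta t,
        forall e, 0 < e -> exists2 t, 0 < t & theta t <= e &
        forall a b c t, 0 <= t ->
          mdist (h a) (h b) <= t * mdist (h a) (h c) ->
          mdist a b <= theta t * mdist a c].
Proof.
move=> [[g' [hK _ _ _]] [eta heta qs]].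
have [g [pos canc mono]] := nneg_homeomorphism_le heta.
have gpos t : 0 <= t -> 0 <= g t by move=> /pos[].
have epos t : 0 <= t -> 0 <= eta t by move=> /pos[].
have gK t : 0 <= t -> eta (g t) = t by move=> /canc[].
have eK t : 0 <= t -> g (eta t) = t by move=> /canc[].
have eta00 : eta 0 = 0.
  apply/eqP; rewrite eq_le (epos 0)// andbT -[X in _ <= X](gK 0)//.
  by apply: mono => //; exact: gpos.
have egt0 t : 0 < t -> 0 < eta t.
  move=> t0; rewrite lt_neqAle epos ?ltW// andbT eq_sym; apply/eqP => et.
  have := eK t (ltW t0); rewrite et -eta00 eK//; lra.
have ggt0 t : 0 < t -> 0 < g t.
  move=> t0; rewrite lt_neqAle gpos ?ltW// andbT eq_sym; apply/eqP => et.
  have := gK t (ltW t0); rewrite et eta00; lra.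
have gmono x y : 0 <= x -> 0 <= y -> eta x <= y -> x <= g y.
  move=> x0 y0 xy; rewrite leNgt; apply/negP => lt.
  have := mono _ _ (gpos _ y0) (ltW lt); rewrite gK// => yx.
  have ey : eta x = y by apply/eqP; rewrite eq_le xy yx.
  by move: lt; rewrite -ey eK// ltxx.
have gmono' x y : 0 <= x -> 0 <= y -> y <= eta x -> g y <= x.
  move=> x0 y0 xy; rewrite leNgt; apply/negP => lt.
  have := mono _ _ x0 (ltW lt); rewrite gK// => yx.
  have ey : eta x = y by apply/eqP; rewrite eq_le xy yx.
  by move: lt; rewrite -ey eK// ltxx.
exists (fun t => Num.max t (g t^-1)^-1); split.
- by move=> t t0; rewrite le_max t0.
- move=> e e0.
  have e1 : 0 < e^-1 by rewrite invr_gt0.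
  have e2 := egt0 _ e1.
  (* The first entry bounds [t] by [e]; the second gives [eta e^-1 <= t^-1], hence
     [e^-1 <= g t^-1]. *)
  exists (Num.min e (eta e^-1)^-1); first by rewrite lt_min e0 invr_gt0.
  rewrite ge_max ge_min lexx /=.
  set t := Num.min _ _.
  have t0 : 0 < t by rewrite lt_min e0 invr_gt0.
  have ti0 : 0 < t^-1 by rewrite invr_gt0.
  rewrite invf_ple ?posrE ?ggt0//.
  apply: gmono; [exact: ltW|exact: ltW|].
  by rewrite -[leLHS]invrK lef_pV2 ?posrE ?invr_gt0// ge_min lexx orbT.
- move=> a b c t t0 le.
  have [<-|ab] := pselect (a = b).
    by rewrite mdistxx mulr_ge0 ?mdist_ge0// le_max t0.
  have hinj := can_inj hK.
  have dab : 0 < mdist a b by rewrite mdist_gt0; apply/eqP.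
  have dhab : 0 < mdist (h a) (h b) by rewrite mdist_gt0; apply/eqP => /hinj.
  have [ac|ac] := pselect (a = c).
    by move: le; rewrite -ac mdistxx mulr0; lra.
  have dac : 0 < mdist a c by rewrite mdist_gt0; apply/eqP.
  have dhac : 0 < mdist (h a) (h c) by rewrite mdist_gt0; apply/eqP => /hinj.
  have [bc|bc] := pselect (b = c).
    have t1 : 1 <= t by rewrite -(ler_pM2r dhac) mul1r; move: le; rewrite bc.
    by rewrite bc ler_peMl ?mdist_ge0// le_max t1.
  (* Exchanging [b] and [c] turns the upper bound on the image ratio into a lower bound on its
     reciprocal. *)
  have := qs a c b ac ab (not_eq_sym bc) => q.
  have t1 : 0 < t.
    by rewrite lt_neqAle t0 andbT; apply/eqP => t00; move: le; rewrite -t00 mul0r; lra.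
  have ti0 : 0 < t^-1 by rewrite invr_gt0.
  have u0 : 0 < mdist a c / mdist a b by rewrite divr_gt0.
  have q2 : t^-1 <= eta (mdist a c / mdist a b).
    apply: le_trans q; rewrite ler_pdivlMr// mulrC ler_pdivrMr//.
    by rewrite [_ * t]mulrC.
  have := gmono' _ _ (ltW u0) (ltW ti0) q2; rewrite ler_pdivlMr// => q3.
  apply: (@le_trans _ _ ((g t^-1)^-1 * mdist a c)).
    by rewrite mulrC ler_pdivlMr ?ggt0// mulrC.
  by rewrite ler_wpM2r ?mdist_ge0// le_max lexx orbT.
Qed.

(** Surjectivity excludes jumps: between [g (f x - e)] and [g (f x + e)] the values stay within [e]
    of [f x]. *)
Lemma nneg_increasing_continuous (R : realType) (f g : R -> R) :
  (forall t, 0 <= t -> 0 <= f t /\ 0 <= g t) ->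
  (forall t, 0 <= t -> g (f t) = t /\ f (g t) = t) ->
  (forall x y, 0 <= x -> x <= y -> f x <= f y) ->
  {within [set t : R | 0 <= t], continuous f}.
Proof.
move=> pos canc mono; apply/subspace_continuousP => x /= x0.
have fpos t : 0 <= t -> 0 <= f t by move=> /pos[].
have gpos t : 0 <= t -> 0 <= g t by move=> /pos[].
have gK t : 0 <= t -> f (g t) = t by move=> /canc[].
apply/cvgrPdist_le => e e0.
have fx0 := fpos x x0.
have fe0 : 0 <= f x + e by lra.
have up : x < g (f x + e).
  rewrite ltNge; apply/negP => /(mono _ _ (gpos _ fe0)).
  rewrite gK//; lra.
(* A negative [f x - e] is outside the range where [g] inverts [f]; there [0 <= f t] suffices. *)
have lo : \forall t \near x, 0 <= t -> f x - e <= f t.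
  have [fe|fe] := ltP (f x - e) 0.
    by near=> t => t0; have := fpos t t0; lra.
  have gx : g (f x - e) < x.
    rewrite ltNge; apply/negP => /(mono _ _ x0).
    rewrite gK//; lra.
  near=> t => t0.
  rewrite -[leLHS](gK (f x - e))//; apply: mono; first exact: gpos.
  by apply: ltW; near: t; exact: lt_nbhsr.
rewrite near_withinE.
near=> t => /= t0.
have h1 : f x - e <= f t by move: t0; near: t; exact: lo.
have h2 : f t <= f x + e.
  rewrite -[leRHS](gK (f x + e))//; apply: mono => //.
  by apply: ltW; near: t; exact: lt_nbhsl.
by rewrite /from_subspace ler_norml; apply/andP; split; lra.
Unshelve. all: by end_near.
Qed.

Lemma nneg_increasing_homeomorphism (R : realType) (f g : R -> R) :
  (forall t, 0 <= t -> 0 <= f t /\ 0 <= g t) ->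
  (forall t, 0 <= t -> g (f t) = t /\ f (g t) = t) ->
  (forall x y, 0 <= x -> x <= y -> f x <= f y) ->
  set_homeomorphism [set t : R | 0 <= t] [set t : R | 0 <= t] f.
Proof.
move=> pos canc mono; exists g; split.
- by split=> t /= /pos[].
- by split=> t; rewrite inE /= => /canc[].
- exact: nneg_increasing_continuous pos canc mono.
apply: (@nneg_increasing_continuous _ _ f).
- by move=> t /pos[].
- by move=> t /canc[].
move=> x y x0 xy; have y0 : 0 <= y := le_trans x0 xy.
rewrite leNgt; apply/negP => lt.
have := mono _ _ (pos y y0).2 (ltW lt).
rewrite (canc x x0).2 (canc y y0).2 => yx.
have e : x = y by apply/eqP; rewrite eq_le xy yx.
by move: lt; rewrite e ltxx.
Qed.

(** The inverse of a maximum of two increasing bijections is the minimum of their inverses. *)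
Lemma max_powR_homeomorphism (R : realType) (k l p q : R) :
  0 < k -> 0 < l -> 0 < p -> 0 < q ->
  set_homeomorphism [set t : R | 0 <= t] [set t : R | 0 <= t]
    (fun t => Num.max (k * t `^ p) (l * t `^ q)).
Proof.
move=> k0 l0 p0 q0.
pose inv (c r : R) u := (u / c) `^ r^-1.
have invK (c r t : R) : 0 < c -> 0 < r -> 0 <= t -> inv c r (c * t `^ r) = t.
  move=> c0 r0 t0; rewrite /inv mulrAC divff ?gt_eqF// mul1r.
  by rewrite -powRrM mulfV ?gt_eqF// powRr1.
have Kinv (c r u : R) : 0 < c -> 0 < r -> 0 <= u -> c * inv c r u `^ r = u.
  move=> c0 r0 u0; rewrite /inv -powRrM mulVf ?gt_eqF// powRr1.
    by rewrite mulrC divfK// gt_eqF.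
  by rewrite divr_ge0// ltW.
have mono (c r x y : R) : 0 < c -> 0 < r -> 0 <= x -> x <= y -> c * x `^ r <= c * y `^ r.
  move=> c0 r0 x0 xy; rewrite ler_pM2l//.
  by apply: ge0_ler_powR; rewrite ?nnegrE ?(ltW r0)// (le_trans x0).
have imono (c r x y : R) : 0 < c -> 0 < r -> 0 <= x -> x <= y -> inv c r x <= inv c r y.
  move=> c0 r0 x0 xy; apply: ge0_ler_powR.
  - by rewrite invr_ge0 ltW.
  - by rewrite nnegrE divr_ge0// ltW.
  - by rewrite nnegrE divr_ge0 ?(ltW c0) ?(le_trans x0 xy).
  - by rewrite ler_pM2r// invr_gt0.
have pow0 (c r t : R) : 0 < c -> 0 <= c * t `^ r.
  by move=> c0; rewrite mulr_ge0 ?powR_ge0// ltW.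
apply: (@nneg_increasing_homeomorphism _ _ (fun u => Num.min (inv k p u) (inv l q u))).
- by move=> t t0; rewrite le_max pow0//= le_min !powR_ge0.
- move=> t t0; split.
    have [le|/ltW le] := leP (k * t `^ p) (l * t `^ q).
      rewrite (invK l)//; apply/min_idPr.
      by have := imono k p _ _ k0 p0 (pow0 _ _ _ k0) le; rewrite invK.
    rewrite (invK k)//; apply/min_idPl.
    by have := imono l q _ _ l0 q0 (pow0 _ _ _ l0) le; rewrite invK.
  have ip (c r u : R) : 0 <= inv c r u by exact: powR_ge0.
  have [le|/ltW le] := leP (inv k p t) (inv l q t).
    rewrite (Kinv k)//; apply/max_idPl.
    by apply: le_trans (mono l q _ _ l0 q0 (ip _ _ _) le) _; rewrite (Kinv l q t).
  rewrite (Kinv l)//; apply/max_idPr.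
  by apply: le_trans (mono k p _ _ k0 p0 (ip _ _ _) le) _; rewrite (Kinv k p t).
- by move=> x y x0 xy; rewrite ge_max !le_max !mono//= orbT.
Qed.

(** The exponent is the logarithm of [y] to base [x], positive because both logarithms are
    negative. *)
Lemma powR_geometric (R : realType) (x y : R) :
  0 < x < 1 -> 0 < y < 1 ->
  exists2 p, 0 < p & forall k, (x ^+ k) `^ p = y ^+ k.
Proof.
move=> /andP[x0 x1] /andP[y0 y1].
have lx : ln x < 0 by rewrite ln_lt0// x0.
have ly : ln y < 0 by rewrite ln_lt0// y0.
exists (ln y / ln x); first by rewrite nmulr_lgt0// invr_lt0.
move=> k; rewrite -powR_mulrn ?(ltW x0)// powRAC powR_mulrn ?powR_ge0//.
by rewrite /powR gt_eqF// divfK ?lt_eqF// lnK.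
Qed.

(** * The equivalence *)

Lemma undistorted_quasisymmetry (R : realType) (X Y : metricType R)
    (C : cell_tree Y) (h : X -> Y) :
  finitely_ramified C -> undistorted C -> homeomorphism h ->
  undistorted (induced_cells h C) -> quasisymmetry h.
Proof.
move=> fr uY hh uX; split=> //.
have [g [hg gh _ _]] := hh.
have cov := finitely_ramified_covering fr.
have [K1 [r1 [s1 [K1_1 r1_0 rs1 s1_1 gX]]]] := undistorted_gauge
  (homeomorphism_bounded fr hh) (induced_covering gh cov) uX.
have [K2 [r2 [s2 [K2_1 r2_0 rs2 s2_1 gY]]]] := undistorted_gauge
  (finitely_ramified_bounded fr) cov uY.
(* [p] turns the lower rate in [X] into the upper rate in [Y]; [q] turns the upper rate in [X] into
   the lower rate in [Y]. *)
have [||p p0 pE] := @powR_geometric _ r1 s2; [by apply/andP; split; lra..|].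
have [||q q0 qE] := @powR_geometric _ s1 r2; [by apply/andP; split; lra..|].
have K1_0 : 0 < K1 by lra.
have K2_0 : 0 < K2 by lra.
exists (fun t => Num.max (K2 * K1 `^ p * t `^ p) (K2 * K1 `^ q * t `^ q)).
  by apply: max_powR_homeomorphism; rewrite ?mulr_gt0 ?powR_gt0.
have split_level n a b : sep_level C n (h a) (h b) ->
    sep_level (induced_cells h C) n a b.
  move=> [L nL]; split; first exact/(linked_induced C n a b gh).
  by move/(linked_induced C n.+1 a b gh).
move=> a b c ab ac bc.
have hinj := can_inj hg.
have dab : 0 < mdist a b by rewrite mdist_gt0; apply/eqP.
have dac : 0 < mdist a c by rewrite mdist_gt0; apply/eqP.
have dhab : 0 < mdist (h a) (h b) by rewrite mdist_gt0; apply/eqP => /hinj.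
have dhac : 0 < mdist (h a) (h c) by rewrite mdist_gt0; apply/eqP => /hinj.
have [n Ln] := sep_level_exists fr uY.1 (contra_not (@hinj a b) ab).
have [m Lm] := sep_level_exists fr uY.1 (contra_not (@hinj a c) ac).
have Ln' := split_level _ _ _ Ln.
have Lm' := split_level _ _ _ Lm.
set t := mdist a b / mdist a c.
have t0 : 0 < t by rewrite divr_gt0.
(* If [b] separates from [a] no earlier than [c], the [p]-power bounds the ratio. Otherwise the
   gauges apply with [b] and [c] exchanged and give the [q]-power. *)
have [mn|/ltnW nm] := leqP m n.
- have /andP[+ _] := gX _ _ _ _ _ mn Ln' Lm'.
  have /andP[_ +] := gY _ _ _ _ _ mn Ln Lm.
  set k := (n - m)%N => hY hX.
  have rt : r1 ^+ k <= K1 * t.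
    by rewrite /t mulrA ler_pdivlMr// -ler_pdivrMl// mulrA [K1^-1 * _]mulrC.
  rewrite le_max; apply/orP; left.
  rewrite ler_pdivrMr//; apply: le_trans hY _.
  rewrite ler_pM2r// -mulrA ler_pM2l// -powRM ?(ltW K1_0) ?(ltW t0)// -pE.
  by apply: ge0_ler_powR => //; rewrite ?nnegrE ?(exprn_ge0 _ (ltW r1_0)) ?(mulr_ge0 (ltW K1_0) (ltW t0)) ?(ltW p0).
- have /andP[_ +] := gX _ _ _ _ _ nm Lm' Ln'.
  have /andP[+ _] := gY _ _ _ _ _ nm Lm Ln.
  set k := (m - n)%N => hY hX.
  have s1_0 : 0 < s1 by lra.
  have st : 1 <= K1 * t * s1 ^+ k.
    have -> : K1 * t * s1 ^+ k = K1 * s1 ^+ k * mdist a b / mdist a c.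
      by rewrite /t; ring.
    by rewrite ler_pdivlMr// mul1r.
  have Kt : 1 <= (K1 * t) `^ q * r2 ^+ k.
    rewrite -qE -powRM ?(exprn_ge0 _ (ltW s1_0)) ?(mulr_ge0 (ltW K1_0) (ltW t0))//.
    have : 1 `^ q <= (K1 * t * s1 ^+ k) `^ q.
      by apply: ge0_ler_powR; rewrite ?nnegrE ?(ltW q0)//; lra.
    by rewrite powR1.
  rewrite le_max; apply/orP; right.
  rewrite ler_pdivrMr// -[K2 * K1 `^ q * _]mulrA -powRM ?(ltW K1_0) ?(ltW t0)//.
  have h1 : mdist (h a) (h b) <=
      (K1 * t) `^ q * r2 ^+ k * mdist (h a) (h b) by rewrite ler_peMl ?(ltW dhab).
  have h2 : K2 * (K1 * t) `^ q * (r2 ^+ k / K2 * mdist (h a) (h b)) <=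
      K2 * (K1 * t) `^ q * mdist (h a) (h c).
    by rewrite ler_wpM2l// mulr_ge0 ?powR_ge0 ?(ltW K2_0).
  have e : K2 * (K1 * t) `^ q * (r2 ^+ k / K2 * mdist (h a) (h b)) =
      (K1 * t) `^ q * r2 ^+ k * mdist (h a) (h b) by field; rewrite gt_eqF.
  by rewrite e in h2; exact: le_trans h1 h2.
Qed.

Theorem corollary14 (R : realType) (X Y : metricType R) (C : cell_tree Y)
    (hC : finitely_ramified C) (hrigid : topologically_rigid C)
    (hund : undistorted C) (phi : X -> Y) (hphi : homeomorphism phi) :
  quasisymmetrically_equivalent X Y <-> undistorted (induced_cells phi C).
Proof.
split=> [[h qs]|uX]; last by exists phi; exact: (undistorted_quasisymmetry hC).
have hh := qs.1.
have [g [hg gh ch cg]] := hh.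
have [psi [pK Kp cp cps]] := hphi.
have [theta [th0 ths th]] := quasisymmetry_inverse_control qs.
have uh := pullback_undistorted gh (homeomorphism_bounded hC hh)
  (finitely_ramified_bounded hC) (finitely_ramified_covering hC) th0 ths th hund.
(* A self-homeomorphism of [Y], to which rigidity applies. *)
have hom : homeomorphism (h \o psi).
  exists (phi \o g); split.
  - by move=> y /=; rewrite hg Kp.
  - by move=> y /=; rewrite pK gh.
  - by move=> y; apply: continuous_comp; [exact: cps|exact: ch].
  - by move=> y; apply: continuous_comp; [exact: cg|exact: cp].
(* The [phi]-preimage of [E] is the [h]-preimage of its image under [h \o psi]. Both conditions
   quantify universally over cells, so this inclusion transfers them with the same constants. *)
have sub n A : cell (induced_cells phi C) n A -> cell (induced_cells h C) n A.
  move=> [E CE <-]; exists ((h \o psi) @` E); first exact: hrigid.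
  apply/seteqP; split=> x /=; rewrite /preimage /=.
    by move=> [y Ey /(can_inj hg) <-]; rewrite Kp.
  by move=> Ex; exists (phi x) => //=; rewrite pK.
case: uh => -[r [s [c [r0 rs s1 c1 dec]]]] [delta d0 sep].
split; last by exists delta => // n E1 E2 /sub C1 /sub C2; exact: sep C1 C2.
exists r, s, c; split=> // m n E E' mn /sub CE /sub CE'.
exact: dec CE CE'.
Qed.
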